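(* Let $\mathcal{C}_1\subset V_1$ and $\mathcal{C}_2\subset V_2$ be proper cones in finite-dimensional real vector spaces, both admitting a kite-square sandwiching. Then $(\mathcal{C}_1,\mathcal{C}_2)$ is entangleable, i.e. $\mathcal{C}_1\odot_{\min}\mathcal{C}_2\neq\mathcal{C}_1\otimes_{\max}\mathcal{C}_2$.
   Context: All vector spaces are real and finite-dimensional. A (convex) cone in $V$ is a subset $\mathcal{C}\subset V$ with $sx+ty\in\mathcal{C}$ for all $x,y\in\mathcal{C}$ and $s,t\in[0,\infty)$. It is proper if it is closed, $\mathcal{C}\cap(-\mathcal{C})=\{0\}$ and $\mathcal{C}-\mathcal{C}=V$. The dual cone is $\mathcal{C}^*=\{f\in V^* : f(x)\geq 0 \text{ for every } x\in\mathcal{C}\}$. For cones $\mathcal{C}_1\subset V_1$, $\mathcal{C}_2\subset V_2$, the minimal tensor product is $$\mathcal{C}_1\odot_{\min}\mathcal{C}_2=\operatorname{conv}\{x_1\otimes x_2 : x_1\in\mathcal{C}_1,\ x_2\in\mathcal{C}_2\}\subset V_1\otimes V_2,$$ and the maximal tensor product is $$\mathcal{C}_1\otimes_{\max}\mathcal{C}_2=\{z\in V_1\otimes V_2 : (f_1\otimes f_2)(z)\geq 0 \text{ for every } f_1\in\mathcal{C}_1^*,\ f_2\in\mathcal{C}_2^*\}.$$ For a convex set $K\subset\mathbb{R}^n$, the cone over $K$ is $\mathscr{C}(K)=\{(x;t)\in\mathbb{R}^n\times[0,\infty) : x\in tK\}\subset\mathbb{R}^n\times\mathbb{R}$, i.e.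 the cone generated by $K\times\{1\}$. The blunt square is $\mathsf{S}_b=[-1,1]^2\setminus\{-1,1\}^2$. For $\alpha=(\alpha_1,\alpha_2,\alpha_3,\alpha_4)\in(-1,1)^4$, the kite $\mathsf{Q}_\alpha$ is $$\mathsf{Q}_\alpha=\operatorname{conv}\{(1,\alpha_1),(\alpha_2,1),(-1,\alpha_3),(\alpha_4,-1)\}\subset\mathbb{R}^2.$$ A proper cone $\mathcal{C}\subset V$ admits a kite-square sandwiching if there exist $\alpha\in(-1,1)^4$ and linear maps $\Psi:\mathbb{R}^3\to V$, $\Phi:V\to\mathbb{R}^3$ such that $\Phi\circ\Psi=\mathrm{Id}$, $\Psi(\mathscr{C}(\mathsf{Q}_\alpha))\subset\mathcal{C}$ and $\Phi(\mathcal{C})\subset\mathscr{C}(\mathsf{S}_b)$ (with $\mathbb{R}^3=\mathbb{R}^2\times\mathbb{R}$). *)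

(* Defs.v *)
From HB Require Import structures.
From mathcomp Require Import all_boot all_order all_algebra.
From mathcomp Require Import all_classical all_reals all_analysis.
Import Order.TTheory GRing.Theory Num.Theory.
Import numFieldNormedType.Exports.
Import passmx.

Set Implicit Arguments.
Unset Strict Implicit.
Unset Printing Implicit Defensive.

Local Open Scope classical_set_scope.
Local Open Scope ring_scope.

Notation "''Dual' ( V )" := 'Hom(V, GRing.regular _) (format "''Dual' ( V )").

(* The tensor product V1 ⊗ V2 of finite-dimensional spaces is modelled, without
   choosing bases, by the linear maps from the dual of V1 to V2: x ⊗ y is the
   map f |-> f x *: y, and f1 ⊗ f2 is the linear form z |-> f2 (z f1). The
   universal property is proved in [tensor_univ] and [tensor_uniq]. *)
Notation "''Tensor' ( V1 , V2 )" := 'Hom('Dual(V1), V2)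
  (format "''Tensor' ( V1 ,  V2 )").

Section Tensor.
Variables (R : realType) (V1 V2 : vectType R).

Definition tens (x : V1) (y : V2) : 'Tensor(V1, V2) :=
  linfun (fun f : 'Dual(V1) => (f x : R) *: y).

Definition dtens (f1 : 'Dual(V1)) (f2 : 'Dual(V2)) : 'Dual('Tensor(V1, V2)) :=
  linfun (fun z : 'Tensor(V1, V2) => f2 (z f1)).

Lemma tensE x y f : tens x y f = (f x : R) *: y.
Proof.
pose g (f : 'Dual(V1)) := (f x : R) *: y.
have lg : linear g.
  by move=> a u v; rewrite /g add_lfunE scale_lfunE scalerDl scalerA.
pose L := GRing.isLinear.Build R _ _ _ g lg.
pose gL : {linear 'Dual(V1) -> V2} := HB.pack g L.
exact: (lfunE gL f).
Qed.

Lemma dtensE f1 f2 z : dtens f1 f2 z = f2 (z f1).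
Proof.
pose g (z : 'Tensor(V1, V2)) := f2 (z f1).
have lg : linear g.
  by move=> a u v; rewrite /g add_lfunE scale_lfunE linearP.
pose L := GRing.isLinear.Build R _ _ _ g lg.
pose gL : {linear 'Tensor(V1, V2) -> R^o} := HB.pack g L.
exact: (lfunE gL z).
Qed.

Lemma dtens_tens f1 f2 x y : dtens f1 f2 (tens x y) = f1 x * f2 y :> R.
Proof. by rewrite dtensE tensE linearZ. Qed.

Let e := vbasis {:V1}.
Let coordf i : 'Dual(V1) := linfun (coord e i : V1 -> R^o).

Let coordfE i x : coordf i x = coord e i x.
Proof. by rewrite lfunE. Qed.

Let sum_coord x : x = \sum_i coord e i x *: e`_i.
Proof. exact: (coord_vbasis (memvf x)). Qed.

Let tens_dec (z : 'Tensor(V1, V2)) : z = \sum_(i < \dim {:V1}) tens e`_i (z (coordf i)).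
Proof.
apply/lfunP => f; rewrite sum_lfunE.
have {1}-> : f = \sum_(i < \dim {:V1}) (f e`_i : R) *: coordf i.
  apply/lfunP => x; rewrite {1}(sum_coord x) sum_lfunE linear_sum.
  by apply: eq_bigr => i _; rewrite linearZ scale_lfunE coordfE; apply: mulrC.
rewrite linear_sum; apply: eq_bigr => i _.
by rewrite linearZ tensE.
Qed.

Lemma tensor_univ (W : lmodType R) (b : {bilinear V1 -> V2 -> W}) :
  exists L : {linear 'Tensor(V1, V2) -> W}, forall x y, L (tens x y) = b x y.
Proof.
pose g (z : 'Tensor(V1, V2)) := \sum_(i < \dim {:V1}) b e`_i (z (coordf i)).
have lg : linear g.
  move=> a u v; rewrite /g scaler_sumr -big_split /=; apply: eq_bigr => i _.
  by rewrite add_lfunE scale_lfunE linearPr.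
pose L := GRing.isLinear.Build R _ _ _ g lg.
pose gL : {linear 'Tensor(V1, V2) -> W} := HB.pack g L.
exists gL => x y; rewrite [LHS]/(g _) /g [in RHS](sum_coord x) linear_sumlz.
by apply: eq_bigr => i _; rewrite tensE coordfE linearZr_LR linearZl_LR.
Qed.

Lemma tensor_uniq (W : lmodType R) (L L' : {linear 'Tensor(V1, V2) -> W}) :
  (forall x y, L (tens x y) = L' (tens x y)) -> L =1 L'.
Proof.
move=> LL' z; rewrite (tens_dec z) !linear_sum.
by apply: eq_bigr => i _; rewrite LL'.
Qed.

End Tensor.

Definition conv_hull (R : realType) (E : lmodType R) (A : set E) : set E :=
  smallest (@convex_set R E) A.

Section Cones.
Variable R : realType.

Definition is_cone (V : vectType R) (C : set V) : Prop :=
  forall x y s t, C x -> C y -> 0 <= s -> 0 <= t -> C (s *: x + t *: y).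

(* A [vectType] carries no topology; V gets the Euclidean one, transported
   along the coordinates in a basis (see [vclosedP] for the independence from
   the basis). *)
Definition vclosed (V : vectType R) (C : set V) : Prop :=
  closed (rVof (vbasis {:V}) @` C).

Definition proper_cone (V : vectType R) (C : set V) : Prop :=
  [/\ is_cone C,
      vclosed C,
      C `&` [set - x | x in C] = [set 0] &
      [set x - y | x in C & y in C] = setT].

Definition dual_cone (V : vectType R) (C : set V) : set 'Dual(V) :=
  [set f | forall x, C x -> 0 <= (f x : R)].

Definition min_tensor (V1 V2 : vectType R) (C1 : set V1) (C2 : set V2) :
    set 'Tensor(V1, V2) :=
  conv_hull [set tens x1 x2 | x1 in C1 & x2 in C2].

Definition max_tensor (V1 V2 : vectType R) (C1 : set V1) (C2 : set V2) :
    set 'Tensor(V1, V2) :=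
  [set z | forall f1 f2, dual_cone C1 f1 -> dual_cone C2 f2 ->
    0 <= (dtens f1 f2 z : R)].

Definition entangleable (V1 V2 : vectType R) (C1 : set V1) (C2 : set V2) :
  Prop := min_tensor C1 C2 <> max_tensor C1 C2.

Definition cone_over n (K : set 'rV[R]_n) : set ('rV[R]_n * R^o)%type :=
  [set p | 0 <= (p.2 : R) /\ [set (p.2 : R) *: k | k in K] p.1].

Definition pt (x y : R) : 'rV[R]_2 := \row_(j < 2) [:: x; y]`_j.

Definition blunt_square : set 'rV[R]_2 :=
  [set v | forall j, v 0 j \in `[-1, 1]] `\`
  [set v | forall j, v 0 j = -1 \/ v 0 j = 1].

Definition kite (a1 a2 a3 a4 : R) : set 'rV[R]_2 :=
  conv_hull [set` [:: pt 1 a1; pt a2 1; pt (-1) a3; pt a4 (-1)]].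

Definition kite_square_sandwiching (V : vectType R) (C : set V) : Prop :=
  exists a1 a2 a3 a4 : R,
    [/\ a1 \in `]-1, 1[, a2 \in `]-1, 1[, a3 \in `]-1, 1[ & a4 \in `]-1, 1[] /\
  exists (Psi : 'Hom(('rV[R]_2 * R^o)%type, V))
         (Phi : 'Hom(V, ('rV[R]_2 * R^o)%type)),
    [/\ (Phi \o Psi)%VF = \1%VF,
        Psi @` cone_over (kite a1 a2 a3 a4) `<=` C &
        Phi @` C `<=` cone_over blunt_square].

End Cones.

Section Closed.
Variable R : realType.

Let linear_rV_continuous m n (g : {linear 'rV[R]_m -> 'rV[R]_n}) :
  continuous g.
Proof.
have gE : (g : _ -> _) =
    \sum_(i < m) (fun u : 'rV[R]_m => u 0 i *: g (delta_mx 0 i)).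
  apply/funext => u; rewrite {1}(row_sum_delta u) linear_sum fct_sumE.
  by apply: eq_bigr => i _; rewrite linearZ.
rewrite gE.
apply: (@big_ind _ (fun f : 'rV[R]_m -> 'rV[R]_n => continuous f)) =>
  [|f h cf ch|i _] u; first exact: (@cst_continuous _ _ (0 : 'rV[R]_n)).
  by apply: (cvgD (cf u) (ch u)).
exact: (@cvgZr_tmp _ _ _ (nbhs u) _ _ _ _ (@coord_continuous R 1 m 0 i u)).
Qed.

Let closed_rVof_change (V : vectType R) (e e' : (\dim {:V}).-tuple V)
    (C : set V) :
  basis_of {:V} e -> basis_of {:V} e' ->
  closed (rVof e' @` C) -> closed (rVof e @` C).
Proof.
move=> be be' cl.
have -> : rVof e @` C = (rVof e' \o vecof e) @^-1` (rVof e' @` C).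
  apply/seteqP; split=> [_ [x Cx <-]|u [x Cx xu]] /=.
    by exists x; rewrite // rVofK.
  by exists x; rewrite // (can_inj (rVofK be') xu) vecofK.
apply: preimage_closed cl => u _.
exact: (@linear_rV_continuous _ _ (rVof e' \o vecof e)).
Qed.

Lemma vclosedP (V : vectType R) (e : (\dim {:V}).-tuple V) (C : set V) :
  basis_of {:V} e -> vclosed C <-> closed (rVof e @` C).
Proof.
by move=> be; split; apply: closed_rVof_change; rewrite ?be ?vbasisP.
Qed.

End Closed.

(* Main.v *)
Require Import Defs.
From HB Require Import structures.
From mathcomp Require Import all_boot all_order all_algebra.
From mathcomp Require Import all_classical all_reals all_analysis.
From mathcomp Require Import ring lra.

(** A kite is a linear image of a diamond: if [(s,t)] is the point where the
    diagonals meet, the cone over the kite consists of the nonnegative multiples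
    of [o + a p + b q] with [|a| + |b| <= 1], where [o = (s,t,1)] and
    [p = (1,l,s)], [q = (m,1,t)] point along the diagonals.  Given two kites,
    transport the Popescu-Rohrlich box of two diamonds to
    [z = o ⊗ o' + (p ⊗ p' + p ⊗ q' + q ⊗ p' - q ⊗ q') / 2], which lies in the
    maximal tensor product.  The CHSH functional
    [2 h h' - (x x' + x y' + y x' - y y')] is positive on products of nonzero
    elements of the cone over the blunt square, the corners being the only
    points where the CHSH bound is attained, whereas its value at [z] is
    [(m - l) (m' - l') / 2].  Exchanging the two coordinates of the second kite
    changes the sign of that number, so it may be assumed nonpositive. *)

Set Implicit Arguments.
Unset Strict Implicit.
Unset Printing Implicit Defensive.

Import Order.TTheory GRing.Theory Num.Theory.
Local Open Scope convex_scope.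
Local Open Scope classical_set_scope.
Local Open Scope ring_scope.

Definition blunt (R : realType) (a b : R) : Prop :=
  [/\ -1 <= a <= 1, -1 <= b <= 1 & -1 < a < 1 \/ -1 < b < 1].

(** In this range [c + d] and [c - d] are nonnegative, so the sum is at most [2 * c]. Were it 2 or
    more, then [c = 1], so [|d| < 1] by bluntness, which forces [a = b = 1], a removed corner. *)
Lemma chsh_lt2_pos (R : realType) (a b c d : R) :
  blunt a b -> blunt c d -> - c <= d <= c ->
  a * (c + d) + b * (c - d) < 2.
Proof.
move=> [/andP[a1 a2] /andP[b1 b2] ab] [/andP[c1 c2] /andP[d1 d2] cd].
move=> /andP[dc1 dc2].
rewrite ltNge; apply/negP => le2.
have pa : 0 <= (1 - a) * (c + d) by apply: mulr_ge0; lra.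
have pb : 0 <= (1 - b) * (c - d) by apply: mulr_ge0; lra.
have c_eq1 : c = 1 by lra.
subst c; have d_lt1 : -1 < d < 1 by case: cd => //; lra.
case: ab => ?.
  have : 0 < (1 - a) * (1 + d) by apply: mulr_gt0; lra.
  lra.
have : 0 < (1 - b) * (1 - d) by apply: mulr_gt0; lra.
lra.
Qed.

Lemma bluntC (R : realType) (a b : R) : blunt a b -> blunt b a.
Proof. by case=> *; split=> //; tauto. Qed.

Lemma bluntNr (R : realType) (a b : R) : blunt a b -> blunt a (- b).
Proof. by case=> ? ? [?|?]; split; first [lra | left; lra | right; lra]. Qed.

Lemma bluntNl (R : realType) (a b : R) : blunt a b -> blunt (- a) b.
Proof. by move/bluntC/bluntNr/bluntC. Qed.

(** Sign changes and exchanges of coordinates carry the other sign patterns of [c + d] and [c - d]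
    to the one in [chsh_lt2_pos]. *)
Lemma chsh_lt2 (R : realType) (a b c d : R) :
  blunt a b -> blunt c d -> a * c + a * d + b * c - b * d < 2.
Proof.
move=> ab cd.
case: (lerP 0 (c + d)) => cd0; case: (lerP 0 (c - d)) => cd1.
- by have := chsh_lt2_pos ab cd; lra.
- by have := chsh_lt2_pos (bluntNr ab) (bluntC cd); lra.
- by have := chsh_lt2_pos (bluntNl ab) (bluntNr (bluntNl (bluntC cd))); lra.
- by have := chsh_lt2_pos (bluntNr (bluntNl ab)) (bluntNr (bluntNl cd)); lra.
Qed.

(** The bracket equals [b * (e + g) + c * (e - g)], hence is at least [- a * (|e + g| + |e - g|)];
    the two absolute values add up to twice the larger of [|e|] and [|g|]. *)
Lemma chsh_ge (R : realType) (a b c d e g : R) :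
  - a <= b <= a -> - a <= c <= a -> - d <= e <= d -> - d <= g <= d ->
  0 <= a * d + 2^-1 * (b * e + b * g + c * e - c * g).
Proof.
move=> /andP[b1 b2] /andP[c1 c2] /andP[e1 e2] /andP[g1 g2].
have mul_ge (u v r : R) : - a <= u <= a -> - r <= v <= r -> - (a * r) <= u * v.
  move=> /andP[? ?] /andP[? ?].
  have : 0 <= (a + u) * (r + v) by apply: mulr_ge0; lra.
  have : 0 <= (a - u) * (r - v) by apply: mulr_ge0; lra.
  lra.
have := mul_ge b (e + g) `|e + g|; have := mul_ge c (e - g) `|e - g|.
rewrite b1 b2 c1 c2 -!ler_norml !lexx => /(_ isT isT) hc /(_ isT isT) hb.
have : 0 <= a * (2 * d - `|e + g| - `|e - g|).
  apply: mulr_ge0; first lra.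
  by case: (ger0P (e + g)) => _; case: (ger0P (e - g)) => _; lra.
lra.
Qed.

Lemma kite_diagonals_meet (R : realType) (a1 a2 a3 a4 : R) :
  a1 \in `]-1, 1[ -> a2 \in `]-1, 1[ -> a3 \in `]-1, 1[ -> a4 \in `]-1, 1[ ->
  exists s t, [/\ -1 < s < 1, -1 < t < 1,
    2 * s = a2 * (1 + t) + a4 * (1 - t) & 2 * t = a1 * (1 + s) + a3 * (1 - s)].
Proof.
rewrite !in_itv /= => /andP[? ?] /andP[? ?] /andP[? ?] /andP[? ?].
(* This is the determinant of the linear system for [s] and [t]; both differences are below 2 in
   absolute value. The witnesses come from Cramer's rule. *)
have k_gt0 : 0 < 4 - (a2 - a4) * (a1 - a3) by nra.
set k := 4 - _ in k_gt0.
exists ((2 * (a2 + a4) + (a2 - a4) * (a1 + a3)) / k).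
exists ((2 * (a1 + a3) + (a1 - a3) * (a2 + a4)) / k).
have k0 : k != 0 by rewrite gt_eqF.
split.
- by rewrite ltr_pdivrMr // ltr_pdivlMr // /k; nra.
- by rewrite ltr_pdivrMr // ltr_pdivlMr // /k; nra.
- by rewrite /k in k0 *; field.
- by rewrite /k in k0 *; field.
Qed.

Lemma dual_conv (R : realType) (V : vectType R) (f : 'Dual(V))
    (u v : convex_lmodType V) (k : {i01 R}) :
  f (u <| k |> v) = k%:num * (f u : R) + (1 - k%:num) * (f v : R) :> R.
Proof.
rewrite [u <| k |> v]/(k%:num *: (u : V) + (1 - k%:num) *: (v : V)).
by rewrite linearD !linearZ.
Qed.

Section Frame.
Variables (R : realType) (V : vectType R).

(** The trace of a sandwiching in [V]: [o], [p], [q] are images under [Psi], while [x], [y], [h] are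
    the coordinates and the height composed with [Phi]. *)
Record frame (C : set V) (o p q : V) (x y h : 'Dual(V)) (s t l m : R) : Prop :=
    Frame {
  frame_oDp : C (o + p);
  frame_oBp : C (o - p);
  frame_oDq : C (o + q);
  frame_oBq : C (o - q);
  frame_o : [/\ x o = s :> R, y o = t :> R & h o = 1 :> R];
  frame_p : [/\ x p = 1 :> R, y p = l :> R & h p = s :> R];
  frame_q : [/\ x q = m :> R, y q = 1 :> R & h q = t :> R];
  frame_st : blunt s t;
  frame_blunt : forall v, C v -> exists a b, [/\ blunt a b, 0 <= (h v : R),
    x v = (h v : R) * a :> R & y v = (h v : R) * b :> R] }.

Lemma frame_swap C o p q x y h s t l m :
  frame C o p q x y h s t l m -> frame C o q p y x h t s m l.
Proof.
case=> ? ? ? ? [? ? ?] [? ? ?] [? ? ?] /bluntC ? fb.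
split=> // v /fb[a [b [? ? ? ?]]].
by exists b, a; split=> //; apply: bluntC.
Qed.

Lemma frame_dual C o p q x y h s t l m (f : 'Dual(V)) :
  frame C o p q x y h s t l m -> dual_cone C f ->
  [/\ - (f o : R) <= (f p : R) <= (f o : R) &
      - (f o : R) <= (f q : R) <= (f o : R)].
Proof.
move=> F fC.
have := fC _ (frame_oDp F); have := fC _ (frame_oBp F).
have := fC _ (frame_oDq F); have := fC _ (frame_oBq F).
rewrite !raddfD !raddfN /=.
move: (f o : R) (f p : R) (f q : R) => a b c *.
by split; lra.
Qed.

Lemma sandwiching_frame (C : set V) : kite_square_sandwiching C ->
  exists o p q x y h s t l m, frame C o p q x y h s t l m.
Proof.
case=> a1 [a2 [a3 [a4 [[ha1 ha2 ha3 ha4] [Psi [Phi [PhiPsi PsiC PhiC]]]]]]].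
have [s [t [s1 t1 es et]]] := kite_diagonals_meet ha1 ha2 ha3 ha4.
(* Chosen so that [o + p] and [o + q] lie over the vertices [(1, a1)] and [(a2, 1)]; by [et] and
   [es], [o - p] and [o - q] then lie over the opposite ones. *)
pose l := (1 + s) * a1 - t; pose m := (1 + t) * a2 - s.
have PK u : Phi (Psi u) = u by rewrite -comp_lfunE PhiPsi id_lfunE.
have coord_lin j : linear (fun u : 'rV[R]_2 * R^o => u.1 0 j : R^o).
  by move=> a u v; rewrite !mxE.
pose coord j : {linear ('rV[R]_2 * R^o)%type -> R^o} :=
  HB.pack (fun u : 'rV[R]_2 * R^o => u.1 0 j : R^o)
    (GRing.isLinear.Build R _ _ _ _ (coord_lin j)).
have snd_lin : linear (fun u : 'rV[R]_2 * R^o => u.2 : R^o) by [].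
pose height : {linear ('rV[R]_2 * R^o)%type -> R^o} :=
  HB.pack (fun u : 'rV[R]_2 * R^o => u.2 : R^o)
    (GRing.isLinear.Build R _ _ _ _ snd_lin).
have coordE j u : (linfun (coord j) u : R) = u.1 0 j by rewrite lfunE.
have heightE u : (linfun height u : R) = u.2 by rewrite lfunE.
have vertexC c u k : 0 <= c ->
    k \in [:: pt 1 a1; pt a2 1; pt (-1) a3; pt a4 (-1)] ->
    u = (c *: k, c : R^o) -> C (Psi u).
  move=> c0 kK ->; apply: PsiC; exists (c *: k, c : R^o) => //; split => //=.
  by exists k => //; apply: sub_gen_smallest.
have row2P (u v : 'rV[R]_2) : u 0 0 = v 0 0 -> u 0 1 = v 0 1 -> u = v.
  move=> e0 e1; apply/rowP; case=> [[|[|//]] i].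
    by rewrite (_ : Ordinal i = 0) //; apply: val_inj.
  by rewrite (_ : Ordinal i = 1) //; apply: val_inj.
have ptE u v : (pt u v 0 0 = u) * (pt u v 0 1 = v) by rewrite !mxE.
exists (Psi (pt s t, 1 : R^o)), (Psi (pt 1 l, s : R^o)),
  (Psi (pt m 1, t : R^o)).
exists (linfun (coord 0) \o Phi)%VF, (linfun (coord 1) \o Phi)%VF,
  (linfun height \o Phi)%VF, s, t, l, m.
have blunt_st : blunt s t by split; first [lra | left; lra].
split=> //.
- rewrite -linearD; apply: (vertexC (1 + s) _ (pt 1 a1)); first lra.
    by rewrite !inE eqxx.
  apply: injective_projections => /=; last lra.
  by apply: row2P; rewrite !mxE /= /l; lra.
- rewrite -linearB; apply: (vertexC (1 - s) _ (pt (-1) a3)); first lra.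
    by rewrite !inE eqxx !orbT.
  apply: injective_projections => /=; last lra.
  by apply: row2P; rewrite !mxE /= /l; lra.
- rewrite -linearD; apply: (vertexC (1 + t) _ (pt a2 1)); first lra.
    by rewrite !inE eqxx !orbT.
  apply: injective_projections => /=; last lra.
  by apply: row2P; rewrite !mxE /= /m; lra.
- rewrite -linearB; apply: (vertexC (1 - t) _ (pt a4 (-1))); first lra.
    by rewrite !inE eqxx !orbT.
  apply: injective_projections => /=; last lra.
  by apply: row2P; rewrite !mxE /= /m; lra.
- by rewrite !comp_lfunE !PK !coordE heightE /= !ptE.
- by rewrite !comp_lfunE !PK !coordE heightE /= !ptE.
- by rewrite !comp_lfunE !PK !coordE heightE /= !ptE.
move=> v Cv.
have [/= h0 [k [kB kN] kE]] : cone_over (@blunt_square R) (Phi v).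
  by apply: PhiC; exists v.
exists (k 0 0), (k 0 1); rewrite !comp_lfunE !coordE heightE -kE !mxE.
split=> //.
have := kB 0; have := kB 1; rewrite !in_itv /= => k1 k0; split=> //.
have [?|/negP k0'] := boolP (-1 < k 0 0 < 1); first by left.
have [?|/negP k1'] := boolP (-1 < k 0 1 < 1); first by right.
have edge (r : R) : -1 <= r <= 1 -> ~ (-1 < r < 1) -> r = -1 \/ r = 1.
  move=> /andP[r1 r2] nr; have [->|rN1] := eqVneq r (-1); first by left.
  right; apply/eqP; apply/contra_notT: nr => rn1.
  by rewrite !lt_neqAle eq_sym rN1 r1 rn1.
case: kN => /= -[[|[|//]] i].
  by rewrite (_ : Ordinal i = 0); [exact: edge | exact: val_inj].
by rewrite (_ : Ordinal i = 1); [exact: edge | exact: val_inj].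
Qed.

End Frame.

Theorem theorem3 (R : realType) (V1 V2 : vectType R)
    (C1 : set V1) (C2 : set V2) :
  proper_cone C1 -> proper_cone C2 ->
  kite_square_sandwiching C1 -> kite_square_sandwiching C2 ->
  entangleable C1 C2.
Proof.
move=> _ _ /sandwiching_frame[ o [p [q [x [y [h [s [t [l [m F]]]]]]]]]].
move=> /sandwiching_frame[ o' [p' [q' [x' [y' [h' [s' [t' [l' [m' F']]]]]]]]]].
wlog lm : p' q' x' y' s' t' l' m' F' / (m - l) * (m' - l') <= 0 => [hw|].
  have [|lm] := lerP ((m - l) * (m' - l')) 0; first exact: hw F'.
  by apply: hw (frame_swap F') _; lra.
pose z := tens o o' + 2^-1 *: (tens p p' + tens p q' + tens q p' - tens q q').
have zE f f' : dtens f f' z = (f o : R) * f' o' + 2^-1 *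
    ((f p : R) * f' p' + (f p : R) * f' q' +
     (f q : R) * f' p' - (f q : R) * f' q') :> R.
  by rewrite linearD linearZ linearB !linearD /= !dtens_tens.
have zmax : max_tensor C1 C2 z.
  move=> f f' /(frame_dual F)[fp fq] /(frame_dual F')[fp' fq']; rewrite zE.
  exact: chsh_ge fp fq fp' fq'.
pose W (u : 'Tensor(V1, V2)) : R := 2 * (dtens h h' u : R) -
  ((dtens x x' u : R) + (dtens x y' u : R) +
   (dtens y x' u : R) - (dtens y y' u : R)).
(* [v ⊗ v'] may be nonzero although [h v = 0], whence the second alternative;
   it excludes [z], at which [h ⊗ h'] is positive. *)
pose D : set 'Tensor(V1, V2) :=
  [set u | 0 < W u \/ W u = 0 /\ (dtens h h' u : R) = 0].
have Dconv : convex_set D.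
  (* Both weights are now strictly positive, so a single positive value among [W u] and [W v]
     suffices. *)
  apply/convex_setW => u v; rewrite !inE => Du Dv k k0 k1; rewrite inE /D /=.
  have -> : W (u <| k |> v) = k%:num * W u + (1 - k%:num) * W v.
    by rewrite /W !dual_conv; ring.
  rewrite dual_conv; move: k0 k1; set c := k%:num => k0 k1.
  have c0 : 0 < 1 - c by rewrite subr_gt0.
  case: Du Dv => [Wu|[-> ->]] [Wv|[-> ->]]; rewrite ?mulr0 ?addr0 ?add0r.
  - by left; apply: addr_gt0; apply: mulr_gt0.
  - by left; apply: mulr_gt0.
  - by left; apply: mulr_gt0.
  - by right.
have minD : min_tensor C1 C2 `<=` D.
  apply: smallest_sub => // _ [v Cv [v' Cv' <-]].
  rewrite /D /= /W !dtens_tens.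
  have [a [b [ab hv -> ->]]] := frame_blunt F Cv.
  have [a' [b' [ab' hv' -> ->]]] := frame_blunt F' Cv'.
  (* The values of [x] and [y] at [v] are multiples of [h v], so [W] vanishes together with the
     height. *)
  have [hv0|hv_gt0] := eqVneq (h v : R) 0.
    by right; rewrite hv0 !mul0r; split; ring.
  have [hv'0|hv'_gt0] := eqVneq (h' v' : R) 0.
    by right; rewrite hv'0 !(mul0r, mulr0); split; ring.
  have hh_gt0 : 0 < (h v : R) * h' v'.
    by rewrite mulr_gt0 // lt_neqAle eq_sym ?hv_gt0 ?hv'_gt0.
  have := chsh_lt2 ab ab'; rewrite -subr_gt0 => /(mulr_gt0 hh_gt0) pos; left.
  apply: lt_le_trans pos _; rewrite le_eqVlt; apply/orP; left; apply/eqP.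
  by ring.
move=> minmax; have /minD : min_tensor C1 C2 z by rewrite minmax.
rewrite /D /= /W !zE.
have [-> -> ->] := frame_o F; have [-> -> ->] := frame_p F.
have [-> -> ->] := frame_q F.
have [-> -> ->] := frame_o F'; have [-> -> ->] := frame_p F'.
have [-> -> ->] := frame_q F'.
(* The bound at [(-s, -t)] and [(s', t')] says that [h ⊗ h'] is positive at [z], against the second
   alternative; [lm] contradicts the first. *)
have := chsh_lt2 (bluntNr (bluntNl (frame_st F))) (frame_st F').
by move=> ? [?|[? ?]]; lra.
Qed.
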